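(* Let $l\ge2$ be fixed and let $\{k_n\}$ be an arbitrary sequence of integers satisfying $1\le k_n\le n-l+1$. Then $$\lim_{n\to\infty}P_n^{\mathrm{sep}}(A^{(n)}_{l;k_n})=(3-2\sqrt2)^{l-1}\,|S_l^{\mathrm{sep}}|.$$ In particular, for $l=3$, $$\lim_{n\to\infty}P_n^{\mathrm{sep}}(A^{(n)}_{3;k_n})=6(3-2\sqrt2)^2,$$ and for $l=4$, $$\lim_{n\to\infty}P_n^{\mathrm{sep}}(A^{(n)}_{4;k_n})=22(3-2\sqrt2)^3.$$
   Context: $S_n$ is the set of permutations of $[n]=\{1,\dots,n\}$, written $\sigma=\sigma_1\sigma_2\cdots\sigma_n$. For $l\in\{2,\dots,n-1\}$ and $k\ge1$ with $k+l-1\le n$, $A^{(n)}_{l;k}\subset S_n$ is the set of $\sigma\in S_n$ for which there exists $a$ with $\{k,k+1,\dots,k+l-1\}=\{\sigma_a,\sigma_{a+1},\dots,\sigma_{a+l-1}\}$. A permutation is separable if it can be constructed from the singleton in $S_1$ by iterating direct sums and skew sums; equivalently (a known result), if it avoids both patterns $2413$ and $3142$. Here $\sigma\in S_n$ contains $\tau\in S_m$ as a pattern if there are indices $1\le i_1<\cdots<i_m\le n$ such that for all $1\le j,j'\le m$, $\sigma_{i_j}<\sigma_{i_{j'}}$ if and only if $\tau_j<\tau_{j'}$; otherwise $\sigma$ avoids $\tau$. $S_n^{\mathrm{sep}}$ is the set of separable permutations in $S_n$, and $P_n^{\mathrm{sep}}$ is the uniform probability measure on $S_n^{\mathrm{sep}}$,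 so $P_n^{\mathrm{sep}}(A)=|A\cap S_n^{\mathrm{sep}}|/|S_n^{\mathrm{sep}}|$ for $A\subset S_n$. *)

(* Defs.v *)
From mathcomp Require Import all_boot all_order all_fingroup all_algebra.
From mathcomp Require Import boolp reals.

Set Implicit Arguments.
Unset Strict Implicit.
Unset Printing Implicit Defensive.

Import GRing.Theory.

(* S_n is ['S_n], with positions and values numbered from 0:
   if [s : 'S_n] represents sigma_1 ... sigma_n, then sigma_(i+1) = s i + 1. *)

Definition dsum_fun m n (s : 'S_m) (t : 'S_n) (i : 'I_(m + n)) : 'I_(m + n) :=
  match split i with
  | inl j => lshift n (s j)
  | inr j => rshift m (t j)
  end.

Definition ssum_fun m n (s : 'S_m) (t : 'S_n) (i : 'I_(m + n)) : 'I_(m + n) :=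
  cast_ord (addnC n m)
    match split i with
    | inl j => rshift n (s j)
    | inr j => lshift m (t j)
    end.

Lemma dsum_inj m n (s : 'S_m) (t : 'S_n) : injective (dsum_fun s t).
Proof.
move=> i j; rewrite /dsum_fun.
case: (split_ordP i) => a ->; case: (split_ordP j) => b -> /eqP.
- by rewrite eq_lshift => /eqP /perm_inj ->.
- by rewrite eq_lrshift.
- by rewrite eq_rlshift.
- by rewrite eq_rshift => /eqP /perm_inj ->.
Qed.

Lemma ssum_inj m n (s : 'S_m) (t : 'S_n) : injective (ssum_fun s t).
Proof.
move=> i j /cast_ord_inj.
case: (split_ordP i) => a ->; case: (split_ordP j) => b -> /eqP.
- by rewrite eq_rshift => /eqP /perm_inj ->.
- by rewrite eq_rlshift.
- by rewrite eq_lrshift.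
- by rewrite eq_lshift => /eqP /perm_inj ->.
Qed.

Definition dsum m n (s : 'S_m) (t : 'S_n) : 'S_(m + n) := perm (@dsum_inj m n s t).

Definition ssum m n (s : 'S_m) (t : 'S_n) : 'S_(m + n) := perm (@ssum_inj m n s t).

Inductive separable : forall n, 'S_n -> Prop :=
| separable_single : separable (1%g : 'S_1)
| separable_dsum m n (s : 'S_m) (t : 'S_n) :
    separable s -> separable t -> separable (dsum s t)
| separable_ssum m n (s : 'S_m) (t : 'S_n) :
    separable s -> separable t -> separable (ssum s t).

Definition Ssep n : {set 'S_n} := [set s | `[< separable s >]].

Definition Psep (R : realType) n (A : {set 'S_n}) : R :=
  (#|A :&: Ssep n|%:R / #|Ssep n|%:R)%R.

(* The position [a] is 0-based, so [a + l <= n] says that the block of [l]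
   consecutive positions fits; [k] is 1-based, hence the [v.+1]. *)
Definition clustered n l k : {set 'S_n} :=
  [set s : 'S_n | [exists a : 'I_n,
     (a + l <= n) &&
     ([set s i | i in [set i : 'I_n | a <= i < a + l]]
        == [set v : 'I_n | k <= v.+1 <= k + l - 1])]].

(* Main.v *)
Require Import Defs.
From mathcomp Require Import all_boot all_order all_fingroup all_algebra.
From mathcomp Require Import boolp classical_sets reals topology normedtype sequences.
From mathcomp Require Import zify ring lra.
Import Order.TTheory GRing.Theory Num.Theory.
Import numFieldNormedType.Exports.

Set Implicit Arguments.
Unset Strict Implicit.
Unset Printing Implicit Defensive.

(* Contracting the block of values k, ..., k+l-1 to a single point is a
   bijection from the separable permutations of [n] clustered on that block to
   pairs of separable permutations of [n-l+1] and [l], with inverse the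
   inflation of the value k. Hence, with s_n = |S_n^sep|, the probability is
   exactly s_(n-l+1) s_l / s_n, and everything reduces to s_n / s_(n+1)
   tending to q = 3 - 2 sqrt 2. Splitting at the first sum-cut, and using the
   symmetry between sums and skew sums given by reversal, shows that the s_n
   are the large Schroeder numbers: S = sum_(n >= 1) s_n x^n satisfies
   S^2 + (x-1) S + x = 0. So W = 1 - x - 2S is a square root of
   1 - 6x + x^2 and satisfies (1 - 6x + x^2) W' = (x-3) W, which gives a
   three-term recurrence; for the ratios it is a perturbation of size O(1/n)
   of the contraction y |-> 1/(6-y), whose fixed point is q. *)

(** * Separable words *)

Definition seq_lt (u v : seq nat) := {in u & v, forall x y, x < y}.

(* Separability of words with distinct letters, up to order isomorphism. The
   empty word is allowed so that subwords of separable words are separable. *)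
Inductive sep : seq nat -> Prop :=
| sep_nil : sep [::]
| sep_one x : sep [:: x]
| sep_lt u v : sep u -> sep v -> seq_lt u v -> sep (u ++ v)
| sep_gt u v : sep u -> sep v -> seq_lt v u -> sep (u ++ v).

(* With [h x] a singleton this is relabelling, with [h x] possibly empty it is
   deletion of letters, and in general it is inflation. *)
Lemma sep_subst (h : nat -> seq nat) (u : seq nat) :
  {in u, forall x, sep (h x)} ->
  {in u &, forall x y, x < y -> seq_lt (h x) (h y)} ->
  sep u -> sep (flatten (map h u)).
Proof.
move=> hs hlt su; elim: su hs hlt => {u} [|x|u v _ IHu _ IHv uv|u v _ IHu _ IHv uv] hs hlt.
- exact: sep_nil.
- by rewrite /= cats0; apply: hs; rewrite inE.
- rewrite map_cat flatten_cat; apply: sep_lt.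
  + by apply: IHu => [x xu|x y xu yu]; [apply: hs|apply: hlt]; rewrite mem_cat ?xu ?yu.
  + by apply: IHv => [x xu|x y xu yu]; [apply: hs|apply: hlt]; rewrite mem_cat ?xu ?yu orbT.
  + move=> x y /flatten_mapP[a au xa] /flatten_mapP[b bv yb].
    by apply: (hlt a b) xa yb; rewrite ?mem_cat ?au ?bv ?orbT //; apply: uv.
- rewrite map_cat flatten_cat; apply: sep_gt.
  + by apply: IHu => [x xu|x y xu yu]; [apply: hs|apply: hlt]; rewrite mem_cat ?xu ?yu.
  + by apply: IHv => [x xu|x y xu yu]; [apply: hs|apply: hlt]; rewrite mem_cat ?xu ?yu orbT.
  + move=> x y /flatten_mapP[a au xa] /flatten_mapP[b bv yb].
    by apply: (hlt a b) xa yb; rewrite ?mem_cat ?au ?bv ?orbT //; apply: uv.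
Qed.

(** Deletion and relabelling are done in one step because a map such as [collapse] is in general
    increasing only on the letters that survive the deletion. *)
Lemma sep_map_filter (P : pred nat) (f : nat -> nat) (u : seq nat) :
  {in u &, forall x y, P x -> P y -> x < y -> f x < f y} ->
  sep u -> sep (map f (seq.filter P u)).
Proof.
move=> fP su; have -> : map f (seq.filter P u)
    = flatten [seq if P x then [:: f x] else [::] | x <- u].
  by elim: u {fP su} => //= x u <-; case: (P x).
apply: sep_subst su => [x _|x y xu yu xy a b].
  by case: (P x); [apply: sep_one|apply: sep_nil].
by case: (boolP (P x)) => // Px; case: (boolP (P y)) => // Py;
  rewrite !inE => /eqP-> /eqP->; apply: fP.
Qed.

Lemma sep_map (f : nat -> nat) (u : seq nat) :
  {in u &, forall x y, x < y -> f x < f y} -> sep u -> sep (map f u).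
Proof.
move=> fP su; rewrite -[u]filter_predT; apply: sep_map_filter su => x y xu yu _ _.
exact: fP.
Qed.

Lemma sep_filter (P : pred nat) (u : seq nat) : sep u -> sep (seq.filter P u).
Proof. by move=> su; rewrite -(map_id (seq.filter P u)); apply: sep_map_filter su. Qed.

Lemma sep_rev (u : seq nat) : sep u -> sep (rev u).
Proof.
elim=> {u} [|x|u v _ su _ sv uv|u v _ su _ sv uv]; rewrite ?rev_cat.
- exact: sep_nil.
- exact: sep_one.
- by apply: sep_gt => // x y; rewrite !mem_rev; apply: uv.
- by apply: sep_lt => // x y; rewrite !mem_rev; apply: uv.
Qed.

(** The constructors allow an empty factor, so the last one used may split trivially; then the word
    is its other factor and the induction hypothesis applies. *)
Lemma sep_decompose (u : seq nat) : sep u -> 1 < size u ->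
  exists v w, u = v ++ w /\ [/\ 0 < size v, 0 < size w, sep v, sep w &
    seq_lt v w \/ seq_lt w v].
Proof.
elim=> {u} [||v w sv IHv sw IHw vw|v w sv IHv sw IHw vw] // s1.
  have [/size0nil v0|v0] := posnP (size v); first by subst v; apply: IHw.
  have [/size0nil w0|w0] := posnP (size w).
    by subst w; rewrite cats0 in s1 *; apply: IHv.
  by exists v, w; split=> //; split=> //; left.
have [/size0nil v0|v0] := posnP (size v); first by subst v; apply: IHw.
have [/size0nil w0|w0] := posnP (size w).
  by subst w; rewrite cats0 in s1 *; apply: IHv.
by exists v, w; split=> //; split=> //; right.
Qed.

(** Sorting the two factors separately already gives a sorted word, which must be the interval
    itself; cutting that interval by length identifies each factor. *)
Lemma perm_iota_cat (u v : seq nat) a n :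
  perm_eq (u ++ v) (iota a n) -> seq_lt u v ->
  perm_eq u (iota a (size u)) /\ perm_eq v (iota (a + size u) (size v)).
Proof.
move=> puv uv; have sz : n = size u + size v.
  by rewrite -size_cat (perm_size puv) size_iota.
have E : sort leq u ++ sort leq v = iota a n.
  apply: (@sorted_eq _ leq); [exact: leq_trans|exact: anti_leq| | |].
  - rewrite sorted_pairwise; last exact: leq_trans.
    rewrite pairwise_cat -!sorted_pairwise; try exact: leq_trans.
    rewrite !sort_sorted; try exact: leq_total.
    rewrite !andbT; apply/allrelP => x y; rewrite !mem_sort => xu yv.
    exact/ltnW/uv.
  - exact/iota_sorted.
  - by apply: perm_trans puv; apply: perm_cat; rewrite perm_sort.
rewrite sz iotaD in E; have /eqP := E.
rewrite eqseq_cat ?size_sort ?size_iota // => /andP[/eqP <- /eqP <-].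
by rewrite ![perm_eq _ (sort _ _)]perm_sym !perm_sort.
Qed.

Lemma perm_iota_shift (v : seq nat) a n :
  perm_eq (map (addn a) v) (iota a n) = perm_eq v (iota 0 n).
Proof.
rewrite -{2}[a]addn0 iotaDl; apply/idP/idP => [|]; last exact: perm_map.
by apply: perm_map_inj => x y; apply: addnI.
Qed.

Lemma perm_iota_unshift (v : seq nat) a n :
  perm_eq v (iota a n) -> map (addn a) (map (subn^~ a) v) = v.
Proof.
move=> pv; rewrite -map_comp -[RHS]map_id; apply/eq_in_map => x.
by rewrite (perm_mem pv) mem_iota /= => /andP[/subnKC].
Qed.

(** * One-line words of permutations *)

Definition word n (s : 'S_n) : seq nat := [seq val (s i) | i <- enum 'I_n].

Lemma size_word n (s : 'S_n) : size (word s) = n.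
Proof. by rewrite size_map size_enum_ord. Qed.

Lemma word_inj n : injective (@word n).
Proof.
move=> s t /eq_in_map st; apply/permP => i; apply: val_inj.
by apply: st; rewrite mem_enum.
Qed.

Lemma perm_word n (s : 'S_n) : perm_eq (word s) (iota 0 n).
Proof.
rewrite -val_enum_ord /word [X in perm_eq X _]map_comp; apply: perm_map.
apply: uniq_perm; rewrite ?(map_inj_uniq (@perm_inj _ s)) ?enum_uniq // => i.
rewrite mem_enum; apply/mapP; exists (s^-1%g i); rewrite ?mem_enum //.
by rewrite permKV.
Qed.

Lemma nth_word n (s : 'S_n) (i : 'I_n) : nth 0 (word s) i = s i.
Proof. by rewrite (nth_map i) ?size_enum_ord // nth_ord_enum. Qed.

Lemma eq_word n (s : 'S_n) (u : seq nat) : size u = n ->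
  (forall i : 'I_n, nth 0 u i = s i) -> u = word s.
Proof.
move=> su us; apply: (@eq_from_nth _ 0); rewrite ?size_word // su => i ilt.
by rewrite (us (Ordinal ilt)) -(nth_word s (Ordinal ilt)).
Qed.

Lemma word_exists (u : seq nat) n : perm_eq u (iota 0 n) -> exists s : 'S_n, word s = u.
Proof.
move=> pu; have su : size u = n by rewrite (perm_size pu) size_iota.
have ult (i : 'I_n) : nth 0 u i < n.
  have : nth 0 u i \in u by rewrite mem_nth ?su.
  by rewrite (perm_mem pu) mem_iota.
have inj : injective (fun i => Ordinal (ult i)).
  move=> i j /(congr1 val) /= /eqP; rewrite nth_uniq ?su ?(perm_uniq pu) ?iota_uniq //.
  by move/eqP/val_inj.
exists (perm inj); apply/esym/eq_word => // i; by rewrite permE.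
Qed.

Lemma word_dsum m n (s : 'S_m) (t : 'S_n) :
  word (dsum s t) = word s ++ map (addn m) (word t).
Proof.
apply/esym/eq_word; first by rewrite size_cat size_map !size_word.
move=> i; rewrite permE /dsum_fun nth_cat size_word.
case: (split_ordP i) => j -> /=; first by rewrite nth_word.
by rewrite addKn (nth_map 0) ?size_word ?nth_word.
Qed.

Lemma word_ssum m n (s : 'S_m) (t : 'S_n) :
  word (ssum s t) = map (addn n) (word s) ++ word t.
Proof.
apply/esym/eq_word; first by rewrite size_cat size_map !size_word.
move=> i; rewrite permE /ssum_fun nth_cat size_map size_word.
case: (split_ordP i) => j -> /=.
  by rewrite (nth_map 0) ?size_word ?nth_word.
by rewrite addKn nth_word.
Qed.

Lemma word_mem_lt n (s : 'S_n) x : x \in word s -> x < n.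
Proof. by rewrite (perm_mem (perm_word s)) mem_iota. Qed.

Lemma separable_sep n (s : 'S_n) : separable s -> sep (word s).
Proof.
elim=> {n s} [|m n s t _ IHs _ IHt|m n s t _ IHs _ IHt].
- have := size_word (1%g : 'S_1); case: (word _) => [|x []] // _; exact: sep_one.
- rewrite word_dsum; apply: sep_lt => //.
    by apply: sep_map IHt => x y _ _; rewrite ltn_add2l.
  by move=> x _ /word_mem_lt xm /mapP[y _ ->]; rewrite ltn_addr.
- rewrite word_ssum; apply: sep_gt => //.
    by apply: sep_map IHs => x y _ _; rewrite ltn_add2l.
  by move=> x _ /word_mem_lt xm /mapP[y _ ->]; rewrite ltn_addr.
Qed.

(** Strong induction on the length through [sep_decompose]. The offset [a] is there because the
    upper factor of a sum lives on an interval that does not start at 0. *)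
Lemma sep_separable (u : seq nat) a n : sep u -> 0 < n -> perm_eq u (iota a n) ->
  exists2 s : 'S_n, separable s & u = map (addn a) (word s).
Proof.
have [N] := ubnP n; elim: N n u a => // N IH n u a /ltnSE leN su n0 pu.
have szu : size u = n by rewrite (perm_size pu) size_iota.
have [n1|n1] := leqP n 1.
  have En : n = 1 by lia.
  move: pu szu; rewrite {}En => pu szu.
  exists (1%g : 'S_1); first exact: separable_single.
  case: u {su} szu pu => [|x []] //= _ /perm_mem/(_ x).
  rewrite !inE eqxx => /esym/eqP ->.
  have := perm_word (1%g : 'S_1); have := size_word (1%g : 'S_1).
  case: (word _) => [|y []] //= _ /perm_mem/(_ y).
  by rewrite !inE eqxx => /esym/eqP ->; rewrite addn0.
rewrite -szu in n1; have [v [w [Eu [v0 w0 sv sw]]]] := sep_decompose su n1.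
have szvw : size v + size w = n by rewrite -size_cat -Eu.
move: n1; subst u; clear szu => _; case=> lt_vw.
  have [pv pw] := perm_iota_cat pu lt_vw.
  have [|s ss Ev] := IH _ _ _ _ sv v0 pv; first by lia.
  have [|t st Ew] := IH _ _ _ _ sw w0 pw; first by lia.
  subst n; exists (dsum s t); first exact: separable_dsum.
  rewrite word_dsum map_cat -map_comp; congr (_ ++ _); first exact: Ev.
  rewrite [LHS]Ew; apply: eq_map => x; apply/esym/addnA.
(* In a skew sum the small values come last, so the interval is split along the swapped word. *)
have pu' : perm_eq (w ++ v) (iota a n) by rewrite perm_catC.
have [pw pv] := perm_iota_cat pu' lt_vw.
have [|s ss Ev] := IH _ _ _ _ sv v0 pv; first by lia.
have [|t st Ew] := IH _ _ _ _ sw w0 pw; first by lia.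
subst n; exists (ssum s t); first exact: separable_ssum.
rewrite word_ssum map_cat -map_comp; congr (_ ++ _); last exact: Ew.
rewrite [LHS]Ev; apply: eq_map => x; apply/esym/addnA.
Qed.

Lemma separableE n (s : 'S_n) : 0 < n -> separable s <-> sep (word s).
Proof.
move=> n0; split; first exact: separable_sep.
move=> /sep_separable/(_ n0 (perm_word s))[t st].
by rewrite (@eq_map _ _ (addn 0) id) // map_id => /word_inj ->.
Qed.

(** * The Schroeder recurrence *)

Definition seps n : seq (seq nat) := [seq u <- permutations (iota 0 n) | `[< sep u >]].

Lemma mem_seps n u : u \in seps n = perm_eq u (iota 0 n) && `[< sep u >].
Proof. by rewrite mem_filter mem_permutations andbC. Qed.

Lemma sepsP n u : reflect (perm_eq u (iota 0 n) /\ sep u) (u \in seps n).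
Proof. by rewrite mem_seps; apply: (iffP andP) => -[pu /asboolP]. Qed.

Lemma seps_uniq n : uniq (seps n).
Proof. exact/filter_uniq/permutations_uniq. Qed.

Lemma size_seps n u : u \in seps n -> size u = n.
Proof. by case/sepsP => /perm_size ->; rewrite size_iota. Qed.

(** Passage from sets of permutations to lists of words. Size 0 is excluded because the empty word
    is [sep] while no permutation in ['S_0] is [separable]. *)
Lemma card_Ssep n (A : {set 'S_n}) (p : pred (seq nat)) : 0 < n ->
  (forall s, (s \in A) = p (word s)) -> #|A :&: Ssep n| = count p (seps n).
Proof.
move=> n0 Ap; rewrite -size_filter cardE -(size_map (@word n)); apply/perm_size/uniq_perm.
- by rewrite map_inj_uniq ?enum_uniq //; apply: word_inj.
- exact/filter_uniq/seps_uniq.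
move=> u; rewrite mem_filter; apply/mapP/andP => [[s]|[pu /sepsP[piu]]].
  rewrite mem_enum !inE Ap => /andP[ps /asboolP ss] ->; split=> //.
  by apply/sepsP; split; [apply: perm_word|apply/separableE].
have [s Es] := word_exists piu; rewrite -{u piu}Es in pu *; move=> /separableE ss.
by exists s => //; rewrite mem_enum !inE Ap pu; apply/asboolP/ss.
Qed.

Lemma card_Ssep_size n : 0 < n -> #|Ssep n| = size (seps n).
Proof.
move=> n0; rewrite -[Ssep n]finset.setTI (@card_Ssep _ _ predT) ?count_predT //.
by move=> s; rewrite inE.
Qed.

(** Counting tool for both bijections below: splitting at the first cut, and inflation. *)
Lemma size_bij (S T U : eqType) (f : S -> T -> U) (A : seq S) (B : seq T) (C : seq U) :
  uniq A -> uniq B -> uniq C ->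
  {in A & B, forall a b, f a b \in C} ->
  (forall a a' b b', a \in A -> a' \in A -> b \in B -> b' \in B ->
    f a b = f a' b' -> a = a' /\ b = b') ->
  {in C, forall c, exists a b, [/\ a \in A, b \in B & c = f a b]} ->
  size C = size A * size B.
Proof.
move=> uA uB uC fC finj fsurj; rewrite -(size_allpairs f); apply/perm_size/uniq_perm => //.
  apply: allpairs_uniq => // x y /allpairsP[[a b] [/= aA bB ->]].
  move=> /allpairsP[[a' b'] [/= aA' bB' ->]] /=.
  by case/finj => // -> ->.
move=> c; apply/idP/allpairsP => [/fsurj[a [b [aA bB ->]]]|[[a b] [/= aA bB ->]]].
  by exists (a, b).
exact: fC.
Qed.

(* For a permutation [u] of [0 .. n-1], the proper cuts [0 < i < n] are the
   decompositions of [u] as a direct sum; those of [rev u] are the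
   decompositions of [u] as a skew sum. *)
Definition cut u i := perm_eq (take i u) (iota 0 i).

(** The search starts at 1 to skip the trivial cut at 0, and the successor turns an index of the
    list into a position. A permutation always has its full length as a cut, so this value is its
    length exactly when it is sum-indecomposable. *)
Definition first_cut u := (find (cut u) (iota 1 (size u))).+1.

Lemma cut_size n u : perm_eq u (iota 0 n) -> cut u n.
Proof. by move=> pu; rewrite /cut take_oversize // (perm_size pu) size_iota. Qed.

Lemma has_cut n u : 0 < n -> perm_eq u (iota 0 n) -> has (cut u) (iota 1 (size u)).
Proof.
move=> n0 pu; apply/hasP; exists n; last exact: cut_size.
by rewrite mem_iota (perm_size pu) size_iota; lia.
Qed.

Lemma first_cut_le n u : 0 < n -> perm_eq u (iota 0 n) -> first_cut u <= n.
Proof.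
move=> n0 pu; have := has_cut n0 pu.
by rewrite /first_cut (perm_size pu) size_iota has_find size_iota.
Qed.

Lemma cut_first_cut n u : 0 < n -> perm_eq u (iota 0 n) -> cut u (first_cut u).
Proof.
move=> n0 pu; have hc := has_cut n0 pu; have := nth_find 0 hc.
by rewrite nth_iota ?add1n // -{2}(size_iota 1 (size u)) -has_find.
Qed.

Lemma first_cut_min u i : 0 < i -> i < first_cut u -> ~~ cut u i.
Proof.
move=> i0 lti; have lei : i.-1 < find (cut u) (iota 1 (size u)).
  by rewrite /first_cut in lti; lia.
have := before_find 0 lei; rewrite nth_iota; first by rewrite add1n prednK // => ->.
by rewrite -[X in _ < X](size_iota 1); apply: leq_trans lei (find_size _ _).
Qed.

(** Cuts up to [size p] depend on [p] alone, and [size p] is one of them, so the search never leaves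
    [p]. *)
Lemma first_cut_cat p v : cut p (size p) -> 0 < size p -> first_cut (p ++ v) = first_cut p.
Proof.
move=> cp p0; rewrite /first_cut size_cat iotaD find_cat.
have E : {in iota 1 (size p), cut (p ++ v) =1 cut p}.
  move=> j; rewrite mem_iota => /andP[_]; rewrite add1n ltnS => jp.
  by rewrite /cut takel_cat.
rewrite (eq_in_find E) (eq_in_has E) ifT //; apply/hasP.
by exists (size p) => //; rewrite mem_iota; lia.
Qed.

(** The number of sum-indecomposable separable permutations of size [i]. *)
Definition indec i := count (fun u => first_cut u == i) (seps i).

Lemma seq_lt_shift (p v : seq nat) i : perm_eq p (iota 0 i) -> seq_lt p (map (addn i) v).
Proof.
move=> pp x _ xp /mapP[y _ ->]; move: xp; rewrite (perm_mem pp) mem_iota /= add0n.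
by move/leq_trans; apply; apply: leq_addr.
Qed.

(** Cutting at the first cut writes [u] uniquely as the direct sum of an indecomposable prefix of
    length [i] and an arbitrary separable permutation. *)
Lemma count_first_cut n i : 0 < i <= n ->
  count (fun u => first_cut u == i) (seps n) = indec i * size (seps (n - i)).
Proof.
case/andP=> i0 lein; rewrite /indec -!size_filter.
apply: (@size_bij _ _ _ (fun p v => p ++ map (addn i) v)).
- exact/filter_uniq/seps_uniq.
- exact: seps_uniq.
- exact/filter_uniq/seps_uniq.
- move=> p v; rewrite !(mem_filter (fun u => first_cut u == i)).
  move=> /andP[/eqP fp /sepsP[pp sp]] /sepsP[pv sv].
  have szp : size p = i by rewrite (perm_size pp) size_iota.
  rewrite first_cut_cat ?szp ?fp ?eqxx ?cut_size //=; apply/sepsP; split.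
    rewrite -(subnKC lein) iotaD; apply: perm_cat => //.
    by rewrite add0n perm_iota_shift.
  apply: sep_lt => //; last exact: seq_lt_shift.
  by apply: sep_map sv => x y _ _; rewrite ltn_add2l.
- move=> p p' v v'; rewrite !(mem_filter (fun u => first_cut u == i)).
  move=> /andP[_ /size_seps szp] /andP[_ /size_seps szp'] _ _ /eqP.
  rewrite eqseq_cat ?szp ?szp' // => /andP[/eqP -> /eqP].
  by move/(inj_map (@addnI i)) ->.
- move=> u; rewrite mem_filter => /andP[/eqP fu /sepsP[pu su]].
  have n0 : 0 < n by lia.
  have szu : size u = n by rewrite (perm_size pu) size_iota.
  have cu := cut_first_cut n0 pu; rewrite fu /cut in cu.
  have sz_take : size (take i u) = i by rewrite size_takel ?szu.
  have pd : perm_eq (drop i u) (iota i (n - i)).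
    rewrite -(perm_cat2l (take i u)) cat_take_drop (perm_trans pu) //.
    by rewrite -{1}(subnKC lein) iotaD add0n perm_cat2r perm_sym.
  (* The two factors are recovered as the letters below [i] and the letters from [i] on, so they
     inherit separability through [sep_filter]. *)
  have Et : take i u = [seq x <- u | x < i].
    rewrite -{2}(cat_take_drop i u) filter_cat.
    rewrite [X in X ++ _](_ : _ = take i u); last first.
      by apply/all_filterP/allP => x; rewrite (perm_mem cu) mem_iota.
    rewrite [X in _ ++ X](_ : _ = [::]) ?cats0 //.
    apply/eqP; rewrite -[_ == _]negbK -has_filter; apply/hasPn => x.
    by rewrite (perm_mem pd) mem_iota -leqNgt => /andP[].
  have Ed : drop i u = [seq x <- u | i <= x].
    rewrite -{2}(cat_take_drop i u) filter_cat.
    rewrite [X in _ ++ X](_ : _ = drop i u); last first.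
      by apply/all_filterP/allP => x; rewrite (perm_mem pd) mem_iota => /andP[].
    rewrite [X in X ++ _](_ : _ = [::]) //.
    apply/eqP; rewrite -[_ == _]negbK -has_filter; apply/hasPn => x.
    by rewrite (perm_mem cu) mem_iota -ltnNge.
  exists (take i u), (map (subn^~ i) (drop i u)); split.
  + rewrite mem_filter; apply/andP; split; last first.
      by apply/sepsP; split=> //; rewrite Et; apply: sep_filter.
    rewrite -[X in _ == X]fu -[in X in _ == X](cat_take_drop i u).
    by rewrite first_cut_cat ?sz_take // /cut take_oversize ?sz_take.
  + apply/sepsP; split; first by rewrite -(perm_iota_shift _ i) (perm_iota_unshift pd).
    apply: sep_map; last by rewrite Ed; apply: sep_filter.
    move=> x y; rewrite (perm_mem pd) !mem_iota => /andP[ix _] _ xy.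
    by rewrite ltn_sub2r //; apply: leq_ltn_trans xy.
  + by rewrite (perm_iota_unshift pd) cat_take_drop.
Qed.

Lemma first_cut_proper n u : 0 < n -> perm_eq u (iota 0 n) ->
  reflect (exists2 i, 0 < i < n & cut u i) (first_cut u != n).
Proof.
move=> n0 pu; apply: (iffP idP) => [fn|[i /andP[i0 ltin] ci]].
  exists (first_cut u); last exact: cut_first_cut n0 pu.
  by rewrite [X in _ && X]ltn_neqAle fn (first_cut_le n0 pu).
by apply/eqP => fn; move: ltin; rewrite -fn => /(first_cut_min i0); rewrite ci.
Qed.

Lemma cut_nth n u i a : perm_eq u (iota 0 n) -> cut u i -> a < n ->
  (nth 0 u a < i) = (a < i).
Proof.
move=> pu cu lta; have szu : size u = n by rewrite (perm_size pu) size_iota.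
have uu : uniq u by rewrite (perm_uniq pu) iota_uniq.
have := perm_mem cu (nth 0 u a); rewrite mem_iota add0n /= => <-.
by rewrite in_take ?mem_nth ?szu // index_uniq ?szu.
Qed.

(** For length at least 2, [sep_decompose] gives a proper cut of [u] or of [rev u]; comparing the
    first and last letters shows that both cannot have one. *)
Lemma first_cut_rev n u : 1 < n -> u \in seps n -> (first_cut (rev u) == n) = (first_cut u != n).
Proof.
move=> n1 /sepsP[pu su]; have n0 : 0 < n := ltnW n1.
have pr : perm_eq (rev u) (iota 0 n) by rewrite perm_rev.
have szu : size u = n by rewrite (perm_size pu) size_iota.
apply/idP/(first_cut_proper n0 pu) => [fr|[i /andP[i0 ltin] cu]].
  rewrite -szu in n1; have [v [w [Eu [v0 w0 sv sw]]]] := sep_decompose su n1.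
  case=> lt_vw.
    exists (size v); first by rewrite v0 -szu Eu size_cat -addn1 leq_add2l.
    by rewrite Eu in pu *; have [pv _] := perm_iota_cat pu lt_vw; rewrite /cut take_size_cat.
  move: fr; rewrite -[_ == _]negbK => /negP[]; apply/(first_cut_proper n0 pr).
  exists (size w); first by rewrite w0 -szu Eu size_cat -add1n leq_add2r.
  rewrite Eu perm_catC in pu; have [pw _] := perm_iota_cat pu lt_vw.
  by rewrite Eu /cut rev_cat take_size_cat ?size_rev // perm_rev.
(* A proper cut of [u] forces its first letter below its last, and a proper cut of [rev u] forces
   the opposite. *)
rewrite -[_ == _]negbK; apply/negP => /(first_cut_proper n0 pr)[j /andP[j0 ltjn] cr].
have := cut_nth pu cu n0; have := cut_nth pu cu (_ : n.-1 < n).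
have := cut_nth pr cr n0; have := cut_nth pr cr (_ : n.-1 < n).
rewrite !nth_rev ?szu //; try lia.
rewrite prednK // subnn subn1; lia.
Qed.

Lemma seps0 : seps 0 = [:: [::]].
Proof. by rewrite /seps /= ifT //; apply/asboolP/sep_nil. Qed.

Lemma seps1 : seps 1 = [:: [:: 0]].
Proof. by rewrite /seps /= ifT //; apply/asboolP/sep_one. Qed.

(** From size 2 on, reversal exchanges indecomposable and decomposable permutations, so exactly half
    are indecomposable. The single permutation of size 1 is indecomposable, which gives the
    correction. *)
Lemma double_indec i : 0 < i -> 2 * indec i = size (seps i) + (i == 1).
Proof.
case: i => [|[|n]] // _; first by rewrite /indec seps1.
set m := n.+2; rewrite (_ : (m == 1) = false) // addn0 -(count_predC (fun u => first_cut u == m)).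
rewrite mul2n -addnn; congr (_ + _).
have pr : perm_eq (seps m) (map rev (seps m)).
  apply: uniq_perm; rewrite ?(map_inj_uniq (can_inj revK)) ?seps_uniq // => u.
  apply/idP/mapP => [/sepsP[pu su]|[v /sepsP[pv sv] ->]].
    exists (rev u); rewrite ?revK //; apply/sepsP.
    by split; [rewrite perm_rev|apply: sep_rev].
  by apply/sepsP; split; [rewrite perm_rev|apply: sep_rev].
rewrite /indec (seq.permP pr) count_map; apply: eq_in_count => u um /=.
exact: first_cut_rev.
Qed.

(** Classify by the first cut [i + 1]; doubling lets [double_indec] eliminate [indec] without
    division. *)
Lemma seps_rec n : 0 < n ->
  2 * size (seps n) =
  \sum_(i < n) (size (seps i.+1) + (i == 0 :> nat)) * size (seps (n - i.+1)).
Proof.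
move=> n0; transitivity (2 * \sum_(i < n) indec i.+1 * size (seps (n - i.+1))); last first.
  by rewrite big_distrr; apply: eq_bigr => i _ /=; rewrite mulnA double_indec.
congr (2 * _); rewrite -(sum1_size (seps n)).
transitivity (\sum_(u <- seps n) \sum_(i < n) (first_cut u == i.+1 : nat)).
  rewrite big_seq [RHS]big_seq; apply: eq_bigr => u /sepsP[pu _].
  have lt : (first_cut u).-1 < n by exact: first_cut_le n0 pu.
  rewrite (bigD1 (Ordinal lt)) //= eqxx big1 ?addn0 // => i.
  by rewrite -val_eqE /= => ne; rewrite eqSS eq_sym (negbTE ne).
rewrite exchange_big; apply: eq_bigr => i _; rewrite -count_first_cut ?ltn_ord //.
by rewrite -sum1_count [RHS]big_mkcond; apply: eq_bigr => u _; case: (_ == _).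
Qed.

(** * Inflation and contraction of a block *)

Lemma iota_rsplit k l r : iota 0 (k + l + r) = iota 0 k ++ iota k l ++ iota (k + l) r.
Proof. by rewrite !iotaD !add0n -catA. Qed.

(** The block will occupy [l] values instead of one, so the letters above [k] move up by [l - 1]. *)
Definition expand k l x := if x < k then x else x + l.-1.

(* Left inverse of [expand k l], applied to the letters of an inflation other
   than [k+1 .. k+l-1]; the letter [k] stands for the whole block. *)
Definition collapse k l x := if x <= k then x else x - l.-1.

Definition inflate k l (t p : seq nat) : seq nat :=
  flatten [seq if x == k then map (addn k) p else [:: expand k l x] | x <- t].

Lemma inflate_split k l t1 t2 p : k \notin t1 -> k \notin t2 ->
  inflate k l (t1 ++ k :: t2) p =
  map (expand k l) t1 ++ map (addn k) p ++ map (expand k l) t2.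
Proof.
move=> k1 k2; rewrite /inflate map_cat flatten_cat /= eqxx.
have E t : k \notin t ->
    flatten [seq if x == k then map (addn k) p else [:: expand k l x] | x <- t]
    = map (expand k l) t.
  by elim: t => //= x t IH; rewrite inE negb_or eq_sym => /andP[/negbTE -> /IH ->].
by rewrite !E.
Qed.

Lemma sep_inflate k l t p : 0 < l -> perm_eq p (iota 0 l) -> sep t -> sep p ->
  sep (inflate k l t p).
Proof.
move=> l0 pp st sp; apply: sep_subst st => [x _|x y _ _ xy a b].
  case: eqP => _; last exact: sep_one.
  by apply: sep_map sp => u v _ _; rewrite ltn_add2l.
have lp c : c \in map (addn k) p -> k <= c < k + l.
  by case/mapP => d; rewrite (perm_mem pp) mem_iota => dl ->; lia.
rewrite /expand; case: (eqVneq x k) => [xk|nx]; case: (eqVneq y k) => [yk|ny].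
- by move: xy; rewrite xk yk ltnn.
- by move=> /lp; rewrite inE => abl /eqP ->; case: (ltnP y k); lia.
- by rewrite inE => /eqP -> /lp; case: (ltnP x k); lia.
- by rewrite !inE => /eqP -> /eqP ->; case: (ltnP x k); case: (ltnP y k); lia.
Qed.

(** Cancels the block. Used with length [l] for the inflated word and with length 1 for the
    contracted one, it reduces both to the letters outside the block. *)
Lemma perm_iota_cat3 (x b y : seq nat) k l r : perm_eq b (iota k l) ->
  perm_eq (x ++ b ++ y) (iota 0 (k + l + r)) =
  perm_eq (x ++ y) (iota 0 k ++ iota (k + l) r).
Proof.
move=> pb; rewrite iota_rsplit perm_catCA (perm_catr _ pb) perm_sym perm_catCA perm_cat2l.
exact: perm_sym.
Qed.

Lemma map_expand_iota k l r : 0 < l ->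
  map (expand k l) (iota 0 k ++ iota (k + 1) r) = iota 0 k ++ iota (k + l) r.
Proof.
move=> l0; rewrite map_cat; congr (_ ++ _).
  rewrite -[RHS]map_id; apply/eq_in_map => x; rewrite mem_iota add0n /= /expand.
  by move=> ->.
have -> : k + l = l.-1 + (k + 1) by lia.
rewrite [RHS]iotaDl; apply/eq_in_map => x; rewrite mem_iota /expand => /andP[kx _].
by rewrite ltnNge (leq_trans _ kx) ?leq_addr //= addnC.
Qed.

Lemma expandK k l x : x != k -> collapse k l (expand k l x) = x.
Proof.
by rewrite /expand /collapse; case: (ltnP x k) => [/ltnW ->|kx xk] //; rewrite ifF; lia.
Qed.

Lemma collapse_id k l : collapse k l k = k.
Proof. by rewrite /collapse leqnn. Qed.

Lemma collapseK k l x : 0 < l -> ~~ (k <= x < k + l) -> expand k l (collapse k l x) = x.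
Proof.
by rewrite /expand /collapse => l0 h; case: (leqP x k) => ?; [rewrite ifT|rewrite ifF]; lia.
Qed.

Lemma expand_notin k l x : 0 < l -> x != k -> ~~ (k <= expand k l x < k + l).
Proof. by rewrite /expand => l0 xk; case: (ltnP x k); lia. Qed.

(** Counterpart of [clustered] on words, with [k] now counted from 0. *)
Definition cluster n l k (u : seq nat) :=
  has (fun a => perm_eq (take l (drop a u)) (iota k l)) (iota 0 (n - l).+1).

Lemma clusterP n l k u : size u = n -> 0 < l ->
  reflect (exists w1 b w2, u = w1 ++ b ++ w2 /\ perm_eq b (iota k l)) (cluster n l k u).
Proof.
move=> szu l0; apply: (iffP hasP) => [[a]|[w1 [b [w2 [Eu pb]]]]].
  move=> _ pb; exists (take a u), (take l (drop a u)), (drop l (drop a u)).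
  by rewrite !cat_take_drop.
have szb : size b = l by rewrite (perm_size pb) size_iota.
exists (size w1); first by rewrite mem_iota -szu Eu !size_cat szb; lia.
by rewrite Eu drop_size_cat // take_size_cat.
Qed.

Lemma uniq_split (t : seq nat) k : uniq t -> k \in t ->
  exists t1 t2, [/\ t = t1 ++ k :: t2, k \notin t1 & k \notin t2].
Proof.
move=> ut kt; case/splitPr: kt ut => t1 t2.
rewrite cat_uniq /= negb_or => /and3P[_ /andP[k1 _] /andP[k2 _]].
by exists t1, t2.
Qed.

(** Here [r] counts the values above the block, which keeps subtraction out of the sizes. *)
Lemma inflate_seps k l r t p : 0 < l ->
  t \in seps (k + 1 + r) -> p \in seps l ->
  inflate k l t p \in seps (k + l + r) /\ cluster (k + l + r) l k (inflate k l t p).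
Proof.
move=> l0 /sepsP[pt st] /sepsP[pp sp].
have ut : uniq t by rewrite (perm_uniq pt) iota_uniq.
have kt : k \in t by rewrite (perm_mem pt) mem_iota; lia.
have si := sep_inflate k l0 pp st sp.
have [t1 [t2 [Et k1 k2]]] := uniq_split ut kt.
have Ei := inflate_split l p k1 k2; rewrite -Et in Ei.
have pb : perm_eq (map (addn k) p) (iota k l) by rewrite perm_iota_shift.
have pi : perm_eq (inflate k l t p) (iota 0 (k + l + r)).
  rewrite Ei (perm_iota_cat3 _ _ _ pb) -map_cat -(map_expand_iota _ _ l0).
  apply: perm_map; rewrite -(@perm_iota_cat3 _ [:: k]) //.
  by rewrite -Et.
split; first exact/sepsP.
apply/clusterP => //; first by rewrite (perm_size pi) size_iota.
by exists (map (expand k l) t1), (map (addn k) p), (map (expand k l) t2).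
Qed.

Lemma filter_block k l (x b y : seq nat) :
  {in x, forall c, ~~ (k <= c < k + l)} -> {in y, forall c, ~~ (k <= c < k + l)} ->
  {in b, forall c, k <= c < k + l} ->
  [seq c <- x ++ b ++ y | k <= c < k + l] = b.
Proof.
move=> hx hy hb; rewrite !filter_cat.
have E z : {in z, forall c, ~~ (k <= c < k + l)} -> [seq c <- z | k <= c < k + l] = [::].
  by move=> hz; apply/eqP; rewrite -[_ == _]negbK -has_filter; apply/hasPn.
rewrite (E x hx) (E y hy) cats0; exact/all_filterP/allP.
Qed.

(** Contraction as a deletion: of the block only its least letter [k] is kept, as its
    representative. *)
Lemma filter_quotient k l (x b y : seq nat) : 0 < l ->
  {in x, forall c, ~~ (k <= c < k + l)} -> {in y, forall c, ~~ (k <= c < k + l)} ->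
  perm_eq b (iota k l) ->
  [seq c <- x ++ b ++ y | ~~ (k < c < k + l)] = x ++ k :: y.
Proof.
move=> l0 hx hy pb; rewrite !filter_cat.
have E z : {in z, forall c, ~~ (k <= c < k + l)} -> [seq c <- z | ~~ (k < c < k + l)] = z.
  move=> hz; apply/all_filterP/allP => c /hz; apply: contra => /andP[/ltnW -> ->] //.
rewrite (E x hx) (E y hy) (_ : [seq c <- b | _] = [:: k]) //.
rewrite -(@filter_pred1_uniq _ b k); first last.
- by rewrite (perm_mem pb) mem_iota; lia.
- by rewrite (perm_uniq pb) iota_uniq.
by apply: eq_in_filter => c; rewrite (perm_mem pb) mem_iota /=; lia.
Qed.

(** The block filter recovers [p], and the quotient filter followed by [collapse] recovers [t]. *)
Lemma inflate_inj k l r t t' p p' : 0 < l ->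
  t \in seps (k + 1 + r) -> t' \in seps (k + 1 + r) -> p \in seps l -> p' \in seps l ->
  inflate k l t p = inflate k l t' p' -> t = t' /\ p = p'.
Proof.
move=> l0.
have split3 s q : s \in seps (k + 1 + r) -> q \in seps l -> exists s1 s2,
    [/\ s = s1 ++ k :: s2, k \notin s1, k \notin s2 & inflate k l s q =
      map (expand k l) s1 ++ map (addn k) q ++ map (expand k l) s2]
    /\ [/\ {in map (expand k l) s1, forall c, ~~ (k <= c < k + l)},
    {in map (expand k l) s2, forall c, ~~ (k <= c < k + l)} &
    perm_eq (map (addn k) q) (iota k l)].
  move=> /sepsP[ps _] /sepsP[pq _].
  have [||s1 [s2 [Es k1 k2]]] := @uniq_split s k.
  - by rewrite (perm_uniq ps) iota_uniq.
  - by rewrite (perm_mem ps) mem_iota; lia.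
  exists s1, s2; rewrite {2}Es inflate_split // perm_iota_shift; split=> //; split=> //.
  + by move=> _ /mapP[c cs ->]; apply: expand_notin => //; apply: contraNneq k1 => <-.
  + by move=> _ /mapP[c cs ->]; apply: expand_notin => //; apply: contraNneq k2 => <-.
move=> ht ht' hp hp'.
have [s1 [s2 [[-> k1 k2 ->] [h1 h2 hb]]]] := split3 _ _ ht hp.
have [s1' [s2' [[-> k1' k2' ->] [h1' h2' hb']]]] := split3 _ _ ht' hp'.
have blk q : perm_eq (map (addn k) q) (iota k l) ->
    {in map (addn k) q, forall c, k <= c < k + l}.
  by move=> pq c; rewrite (perm_mem pq) mem_iota.
move=> E; split; last first.
  apply: (inj_map (@addnI k)).
  by rewrite -(filter_block h1 h2 (blk _ hb)) E (filter_block h1' h2' (blk _ hb')).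
have := filter_quotient l0 h1 h2 hb; rewrite E (filter_quotient l0 h1' h2' hb').
move=> /(congr1 (map (collapse k l))); rewrite !map_cat /= collapse_id.
have mapK s : k \notin s -> map (collapse k l) (map (expand k l) s) = s.
  move=> ks; rewrite -map_comp map_id_in // => c cs /=; apply: expandK.
  by apply: contraNneq ks => <-.
by rewrite !mapK.
Qed.

(** The same two filters, relabelled, supply the witnesses; as subwords of [w] they are
    separable. *)
Lemma inflate_surj k l r w : 0 < l ->
  w \in seps (k + l + r) -> cluster (k + l + r) l k w ->
  exists t p, [/\ t \in seps (k + 1 + r), p \in seps l & w = inflate k l t p].
Proof.
move=> l0 ws /(clusterP _ (size_seps ws) l0)[x [b [y [Ew pb]]]].
move: ws => /sepsP[pw sw]; have uw : uniq w by rewrite (perm_uniq pw) iota_uniq.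
have [hx hy] : {in x, forall c, ~~ (k <= c < k + l)} /\
    {in y, forall c, ~~ (k <= c < k + l)}.
  move: uw; rewrite Ew uniq_catCA cat_uniq => /and3P[_ /hasPn xyb _].
  by split=> c cz; rewrite -mem_iota -(perm_mem pb); apply: xyb; rewrite mem_cat cz ?orbT.
have collapse_lt : {in w &, forall c d, ~~ (k < c < k + l) -> ~~ (k < d < k + l) ->
    c < d -> collapse k l c < collapse k l d}.
  by move=> c d _ _; rewrite /collapse; case: (leqP c k); case: (leqP d k); lia.
have /= st := sep_map_filter collapse_lt sw.
have := sep_filter (fun c => k <= c < k + l) sw.
rewrite {1}Ew (filter_quotient l0 hx hy pb) map_cat /= collapse_id in st.
rewrite {1}Ew filter_block // => [sb|c]; last by rewrite (perm_mem pb) mem_iota.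
have k_out z : {in z, forall c, ~~ (k <= c < k + l)} -> k \notin map (collapse k l) z.
  move=> hz; apply/mapP => -[c /hz cz]; rewrite /collapse; case: (leqP c k); lia.
have mapK z : {in z, forall c, ~~ (k <= c < k + l)} ->
    map (expand k l) (map (collapse k l) z) = z.
  by move=> hz; rewrite -map_comp map_id_in // => c /hz; apply: collapseK.
exists (map (collapse k l) x ++ k :: map (collapse k l) y), (map (subn^~ k) b); split.
- apply/sepsP; split=> //.
  rewrite -[k :: _]/([:: k] ++ _) perm_iota_cat3 //.
  (* With [k] cancelled, the letters are compared after the injective [expand], which turns them
     back into the letters of [w] outside the block. *)
  apply: (perm_map_inj (f := expand k l)).
    by move=> c d; rewrite /expand; case: (ltnP c k); case: (ltnP d k); lia.
  by rewrite map_expand_iota // map_cat !mapK // -(perm_iota_cat3 _ _ _ pb) -Ew.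
- apply/sepsP; rewrite -(perm_iota_shift _ k) (perm_iota_unshift pb); split=> //.
  apply: sep_map sb => c d; rewrite !(perm_mem pb) !mem_iota; lia.
- by rewrite inflate_split ?k_out // !mapK // (perm_iota_unshift pb).
Qed.

Lemma count_cluster k l r : 0 < l ->
  count (cluster (k + l + r) l k) (seps (k + l + r)) = size (seps (k + 1 + r)) * size (seps l).
Proof.
move=> l0; rewrite -size_filter; apply: (@size_bij _ _ _ (inflate k l)).
- exact: seps_uniq.
- exact: seps_uniq.
- exact/filter_uniq/seps_uniq.
- move=> t p ht hp; rewrite (mem_filter (cluster _ l k)).
  by have [-> ->] := inflate_seps l0 ht hp.
- by move=> t t' p p' ht ht' hp hp'; apply: inflate_inj l0 ht ht' hp hp'.
- move=> w; rewrite (mem_filter (cluster _ l k)) => /andP[cw sw].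
  exact: inflate_surj.
Qed.

Lemma clustered_word n l k (s : 'S_n) : 1 < l -> l <= n ->
  (s \in clustered n l k.+1) = cluster n l k (word s).
Proof.
move=> l1 ln; rewrite inE.
have szw := size_word s; have uw : uniq (word s) by rewrite (perm_uniq (perm_word s)) iota_uniq.
have blockE a : a + l <= n ->
    ([set s i | i in [set i : 'I_n | a <= i < a + l]]
      == [set v : 'I_n | k.+1 <= v.+1 <= k.+1 + l - 1])
    = perm_eq (take l (drop a (word s))) (iota k l).
  move=> al; set B := take l _.
  have szB : size B = l by rewrite size_takel // size_drop szw; lia.
  have memB (v : 'I_n) : (v \in [set s i | i in [set i : 'I_n | a <= i < a + l]])
      = (val v \in B).
    apply/imsetP/(nthP 0) => [[i]|[j]]; rewrite szB.
      rewrite inE => ai ->; exists (i - a); first by lia.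
      by rewrite nth_take ?nth_drop ?subnKC ?nth_word //; lia.
    move=> jl; rewrite nth_take // nth_drop => Ev.
    have lt : a + j < n by lia.
    exists (Ordinal lt); first by rewrite inE /=; lia.
    by apply: ord_inj; rewrite -nth_word; apply: esym Ev.
  apply/eqP/idP => [E|pe].
    (* [B] has distinct letters, lies in the interval and has its length, hence is a rearrangement
       of it. *)
    have uB : uniq B by rewrite take_uniq ?drop_uniq.
    have subB : {subset B <= iota k l}.
      move=> x xB; have ltx : x < n by apply: (word_mem_lt (s := s)); apply: mem_drop (mem_take xB).
      have := memB (Ordinal ltx); rewrite E inE xB mem_iota /=; lia.
    apply: uniq_perm; rewrite ?iota_uniq //.
    by apply: (uniq_min_size uB subB _).2; rewrite szB size_iota.
  by apply/setP => v; rewrite memB inE (perm_mem pe) mem_iota /=; lia.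
apply/existsP/hasP => [[a /andP[al]]|[a]].
  by rewrite blockE // => pe; exists (val a) => //; rewrite mem_iota /=; lia.
rewrite mem_iota => an pe; have lt : a < n by lia.
by exists (Ordinal lt); rewrite /= blockE //; lia.
Qed.

Lemma card_clustered n l k : 1 < l -> l <= n -> 1 <= k <= n - l + 1 ->
  #|clustered n l k :&: Ssep n| = size (seps (n - l + 1)) * size (seps l).
Proof.
case: k => // k l1 ln /= kn; rewrite (@card_Ssep _ _ (cluster n l k)); first last.
- by move=> s; apply: clustered_word.
- lia.
have En : n = k + l + (n - l - k) by lia.
rewrite {1 2}En count_cluster; last exact: ltnW.
by congr (size (seps _) * _); lia.
Qed.

(** * The three-term recurrence and the limit ratio *)

(** In [seps_rec] the cut at full length contributes [size (seps n.+1)], which cancels one of the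
    two copies on the left; the correction at [i = 0] contributes [size (seps n)]. *)
Lemma seps_conv n : size (seps n.+1) =
  size (seps n) + \sum_(i < n) size (seps i.+1) * size (seps (n - i)).
Proof.
have := seps_rec (ltn0Sn n).
under eq_bigr do rewrite mulnDl subSS.
rewrite big_split /= big_ord_recr /= subnn seps0 muln1 (big_ord_recl n) /= mul1n subn0.
rewrite [X in _ + (_ + X)]big1 //; lia.
Qed.

Local Open Scope classical_set_scope.
Local Open Scope ring_scope.

(* [seps 0] contains the empty word, whence the special case. *)
Definition schroeder_poly N : {poly rat} :=
  \poly_(i < N) (if i == 0%N then 0 else (size (seps i))%:R).

(** The power series equation, stated for truncations as a congruence modulo ['X^N]: all
    coefficients below [N] vanish, by [seps_conv]. *)
Lemma schroeder_equation N : exists Q : {poly rat},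
  schroeder_poly N ^+ 2 + ('X - 1) * schroeder_poly N + 'X = Q * 'X^N.
Proof.
set S := schroeder_poly N; set E := (X in exists Q, X = _).
exists (drop_poly N E); rewrite -{1}(poly_take_drop N E) -[RHS]add0r; congr (_ + _).
apply/polyP => n; rewrite coef_take_poly coef0; case: ifP => // nN.
have coefS i : (i <= n)%N -> S`_i = if i == 0%N then 0 else (size (seps i))%:R.
  by move=> le; rewrite coef_poly (leq_ltn_trans le nN).
rewrite /E !coefD mulrBl mul1r coefB coefXM coefX expr2 coefM.
rewrite (coefS n) //; case: n nN coefS => [|n] nN coefS /=.
  by rewrite big_ord1 (coefS 0) //= mul0r !subr0 !addr0.
rewrite (coefS n) // big_ord_recl big_ord_recr /= (coefS 0%N) //= mul0r add0r subnn.
rewrite [S`_(0)](coefS 0%N) // mulr0 addr0.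
rewrite (seps_conv n) natrD natr_sum.
rewrite [X in X + _ + _](_ : _ = \sum_(i < n) (size (seps i.+1) * size (seps (n - i)))%:R);
    last first.
  apply: eq_bigr => i _; have ltin := ltn_ord i.
  rewrite /bump /= add1n subSS !coefS ?natrM //=; try lia.
  by rewrite subn_eq0 leqNgt ltin.
(* The summand ['X] restores the constant term 1 that [schroeder_poly] sets to 0. *)
have : (if n == 0%N then 0 else (size (seps n))%:R) + (n.+1 == 1%N)%:R
    = (size (seps n))%:R :> rat.
  by rewrite eqSS; case: eqP => [->|_]; rewrite ?seps0 ?add0r ?addr0.
by set A := (if _ then _ else _); set B := (_ == _)%:R => <-; ring.
Qed.

Lemma seps_recurrence m :
  (m.+3 * size (seps m.+3) + m * size (seps m.+1) = (6 * m + 9) * size (seps m.+2))%N.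
Proof.
(* Differentiating loses one power of ['X]: truncation at [N + 1] gives congruences modulo
   ['X^N]. *)
pose N := m.+4; set S := schroeder_poly N.+1.
have [Q EQ] := schroeder_equation N.+1; rewrite -/S in EQ.
pose W : {poly rat} := 1 - 'X - 2 * S.
pose D : {poly rat} := 1 - 6 * 'X + 'X ^+ 2.
pose G := D * W^`() - ('X - 3) * W.
have WW : W ^+ 2 = D + (Q * 'X^(N.+1)) *+ 4 by rewrite -EQ /W /D; ring.
have dD : D^`() = 2 * ('X - 3).
  by rewrite /D derivCE -!polyCMn !derivE; ring.
(* The product is [D * (W ^+ 2)^() - D^() * W ^+ 2] (with formal derivatives), which would vanish if
   [W ^+ 2] were exactly [D]. *)
have dvdW : dvdp 'X^N (W * (2 * G)).
  have E : W * (2 * G) = D * (W ^+ 2)^`() - 2 * ('X - 3) * W ^+ 2.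
    by rewrite /G expr2 derivM; ring.
  rewrite E WW derivD dD derivMn derivM derivXn /= exprS.
  set X := 'X^N; apply/dvdpP.
  exists (4 * D * (Q^`() * 'X + Q *+ N.+1) - 8 * ('X - 3) * Q * 'X).
  by rewrite -(mulr_natr X) -(mulr_natr Q); ring.
(* [W] has constant term 1, so it is coprime to ['X] and can be cancelled. *)
have dvdG : dvdp 'X^N (2 * G).
  rewrite -(@Gauss_dvdpr _ _ W) // coprimep_expl // coprimep_sym coprimepX.
  rewrite /root /W !hornerE.
  by rewrite horner_coef0 coef_poly mulr0 subr0 oner_eq0.
have coefG : (2 * G)`_m.+2 = 0.
  by case/dvdpP: dvdG => q ->; rewrite coefMXn ltnS leqnSn.
have GE : 2 * G = (W^`() - 'X * W^`() *+ 6 + 'X * ('X * W^`()) - 'X * W + W *+ 3) *+ 2.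
  by rewrite /G /D; ring.
have coefW i : (i <= m.+2)%N -> W`_i.+1 = - (i == 0%N)%:R - (size (seps i.+1))%:R *+ 2.
  move=> im; rewrite /W mulr_natl !coefB coef1 coefX coefMn coef_poly /=.
  by rewrite ifT ?sub0r // /N; lia.
(* For [m = 0] the coefficient of ['X] in [W] has an extra -1, which the factor [m] removes. *)
have coefWm : W`_m.+1 *+ m = - (size (seps m.+1))%:R *+ 2 *+ m.
  have [->|m0] := posnP m; first by rewrite !mulr0n.
  by rewrite coefW ?(gtn_eqF m0) ?oppr0 ?sub0r ?mulNrn //; lia.
move: coefG; rewrite {}GE; clear -coefW coefWm; clearbody W.
rewrite !(coefMn, coefN, coefD, coefXM, coef_deriv) /= (coefW m.+2) // (coefW m.+1) //=.
move: coefWm; set w := W`_m.+1; move=> wm eq0; apply/eqP; rewrite -(eqr_nat rat).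
rewrite !(natrD, natrM).
set a1 := (size _)%:R in wm eq0 *; set a2 := (size _)%:R in wm eq0 *.
set a3 := (size _)%:R in wm eq0 *.
by apply/eqP; lra.
Qed.

Lemma size_seps2 : size (seps 2) = 2%N.
Proof. by rewrite (seps_conv 1) big_ord1 seps1. Qed.

(** Gives positivity and ratios at most 1/2, which bounds the denominators in [seps_ratio_error]. *)
Lemma seps_double n : (0 < size (seps n.+1))%N /\ (2 * size (seps n.+1) <= size (seps n.+2))%N.
Proof.
elim: n => [|m [a1 a12]].
  by rewrite size_seps2 seps1.
have := seps_recurrence m; nia.
Qed.

(** * Convergence of the ratios *)

Definition seps_ratio (R : realType) n : R := (size (seps n.+1))%:R / (size (seps n.+2))%:R.

(** The smaller root of 1 - 6x + x^2, which is the radius of convergence of S. *)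
Definition radius (R : realType) : R := 3 - 2 * Num.sqrt 2.

Lemma radius_bounds (R : realType) :
  [/\ 0 < radius R, radius R < 1 & radius R * (6 - radius R) = 1].
Proof.
have s2 : Num.sqrt 2 ^+ 2 = 2 :> R by rewrite sqr_sqrtr.
have s0 : 0 <= Num.sqrt 2 :> R by exact: sqrtr_ge0.
by rewrite /radius; split; nra.
Qed.

(** If u is the current ratio and M its index, the next ratio is (M+3)/(6M+9-Mu). Its distance to q
    has numerator q(9-3q+M(u-q)), at most 2 since q <= 1/5 and the induction hypothesis gives M|u-q|
    <= 1; the denominator is at least 2(M+2). *)
Lemma seps_ratio_error (R : realType) n :
  `|seps_ratio R n - radius R| <= n.+1%:R^-1.
Proof.
have [q0 q1 qq] := radius_bounds R.
elim: n => [|m IH].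
  rewrite /seps_ratio size_seps2 seps1 invr1 ler_norml /=; lra.
have [a1 a12] := seps_double m; have [a2 a23] := seps_double m.+1.
have rec := seps_recurrence m.
move: IH; rewrite /seps_ratio.
set x := (size (seps m.+1))%:R : R; set y := (size (seps m.+2))%:R : R.
set z := (size (seps m.+3))%:R : R.
have x0 : 0 < x by rewrite ltr0n.
have y0 : 0 < y by rewrite ltr0n.
have z0 : 0 < z by rewrite ltr0n; lia.
have xy : 2 * x <= y by rewrite -natrM ler_nat.
have xyz : (m%:R + 3) * z + m%:R * x = (6 * m%:R + 9) * y.
  move/(congr1 (fun n => n%:R : R)): rec; rewrite !(natrD, natrM) -/x -/y -/z => <-.
  by ring.
have m0 : 0 <= m%:R :> R by rewrite ler0n.
set q := radius R in q0 q1 qq *.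
rewrite !ler_norml.
have -> : m.+1%:R = m%:R + 1 :> R by rewrite -natr1.
have -> : m.+2%:R = m%:R + 2 :> R by rewrite -addn2 natrD.
move: (m%:R : R) m0 xyz => M M0 xyz.
set u := x / y => /andP[lu uu].
have Ex : x = u * y by rewrite /u divfK ?gt_eqF.
have den : (M + 3) * z = (6 * M + 9 - M * u) * y by rewrite Ex in xyz; lra.
have u2 : 2 * u <= 1 by rewrite /u mulrA ler_pdivrMr // mul1r.
have den0 : 0 < 6 * M + 9 - M * u by nra.
have -> : y / z = (M + 3) / (6 * M + 9 - M * u).
  by apply/eqP; rewrite eqr_div ?lt0r_neq0 // den mulrC.
have Mu : -1 <= M * (u - q) <= 1.
  have M1 : 0 < M + 1 by lra.
  have i0 : 0 < (M + 1)^-1 by rewrite invr_gt0.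
  have i1 : (M + 1) * (M + 1)^-1 = 1 by rewrite divff // gt_eqF.
  apply/andP; split; nra.
(* Writing M + 3 as (M + 3) q (6 - q) cancels the terms 6Mq. *)
have -> : (M + 3) / (6 * M + 9 - M * u) - q =
    q * (9 - 3 * q + M * (u - q)) / (6 * M + 9 - M * u).
  apply: (mulIf (lt0r_neq0 den0)); rewrite mulrBl !divfK ?lt0r_neq0 //.
  have : (M + 3) * (q * (6 - q)) = M + 3 by rewrite qq mulr1.
  lra.
have q5 : 5 * q <= 1 by nra.
move: Mu; set t := M * (u - q) => /andP[lt ut].
have M2 : 0 < M + 2 by lra.
have i0 : 0 < (M + 2)^-1 by rewrite invr_gt0.
have i1 : (M + 2)^-1 * (M + 2) = 1 by rewrite mulVf // lt0r_neq0.
have den2 : 2 * (M + 2) <= 6 * M + 9 - M * u by nra.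
have inv_den : 2 <= (M + 2)^-1 * (6 * M + 9 - M * u).
  by apply: le_trans (ler_wpM2l (ltW i0) den2); rewrite mulrCA i1 mulr1.
have num0 : 0 <= q * (9 - 3 * q + t) by apply: mulr_ge0; lra.
have num2 : q * (9 - 3 * q + t) <= 2 by nra.
apply/andP; split; last by rewrite ler_pdivrMr //; lra.
by apply: (@le_trans _ _ 0); [lra|apply: divr_ge0; lra].
Qed.

Lemma seps_ratio_cvg (R : realType) : seps_ratio R @ \oo --> radius R.
Proof.
apply/subr_cvg0/norm_cvg0P.
apply: (squeeze_cvgr (f := fun=> 0) (h := harmonic)).
- by apply: nearW => n; rewrite normr_ge0 seps_ratio_error.
- exact: cvg_cst.
- exact: cvg_harmonic.
Qed.

(** The quotient telescopes into [j] consecutive ratios, each tending to [radius R]. *)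
Lemma seps_shift_ratio_cvg (R : realType) j :
  (fun n => (size (seps n.+1))%:R / (size (seps (n + j).+1))%:R : R) @ \oo --> radius R ^+ j.
Proof.
elim: j => [|j IH].
  rewrite expr0 (_ : (fun n => _) = (fun=> 1)); first exact: cvg_cst.
  apply/funext => n; rewrite addn0 divff // pnatr_eq0 -lt0n; exact: (seps_double n).1.
rewrite exprSr (_ : (fun n => _) = (fun n => (size (seps n.+1))%:R / (size (seps (n + j).+1))%:R *
    seps_ratio R (n + j))).
  apply: cvgM => //; rewrite (cvg_shiftn j (seps_ratio R)); exact: seps_ratio_cvg.
apply/funext => n; rewrite /seps_ratio addnS mulrA divfK //.
by rewrite pnatr_eq0 -lt0n; exact: (seps_double (n + j)).1.
Qed.

Theorem corollary2 (R : realType) :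
  (forall (l : nat) (k : nat -> nat),
     (2 <= l)%N ->
     (forall n : nat, (l < n)%N -> (1 <= k n <= n - l + 1)%N) ->
     (fun n : nat => Psep R (clustered n l (k n))) @ \oo -->
       ((3 - 2 * Num.sqrt 2) ^+ (l - 1) * #|Ssep l|%:R : R))
  /\
  (forall k : nat -> nat,
     (forall n : nat, (3 < n)%N -> (1 <= k n <= n - 3 + 1)%N) ->
     (fun n : nat => Psep R (clustered n 3 (k n))) @ \oo -->
       (6 * (3 - 2 * Num.sqrt 2) ^+ 2 : R))
  /\
  (forall k : nat -> nat,
     (forall n : nat, (4 < n)%N -> (1 <= k n <= n - 4 + 1)%N) ->
     (fun n : nat => Psep R (clustered n 4 (k n))) @ \oo -->
       (22 * (3 - 2 * Num.sqrt 2) ^+ 3 : R)).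
Proof.
have main (l : nat) (k : nat -> nat) : (2 <= l)%N ->
    (forall n : nat, (l < n)%N -> (1 <= k n <= n - l + 1)%N) ->
    (fun n : nat => Psep R (clustered n l (k n))) @ \oo -->
      ((3 - 2 * Num.sqrt 2) ^+ (l - 1) * #|Ssep l|%:R : R).
  move=> l2 hk; rewrite card_Ssep_size; last exact: ltnW.
  (* The bounds on [k] are available only for indices above [l]; after the shift by [l + 1], the
     contracted size [n - l + 1] reads [n + 2]. *)
  rewrite -(cvg_shiftn l.+1) /=.
  rewrite (_ : (fun n => _) = (fun n => (size (seps n.+2))%:R /
    (size (seps (n.+1 + (l - 1)).+1))%:R * (size (seps l))%:R)).
    apply: cvgMl; have := @seps_shift_ratio_cvg R (l - 1).
    by rewrite -(cvg_shiftn 1); under eq_fun do rewrite addn1.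
  apply/funext => n; rewrite /Psep card_clustered ?card_Ssep_size //; try lia.
    rewrite natrM mulrAC; congr (_%:R / _%:R * _); congr (size (seps _)); lia.
  by apply: hk; lia.
(* The values 6 and 22 come from the convolution [seps_conv], starting from 1 and 2. *)
have s3 : size (seps 3) = 6%N by rewrite (seps_conv 2) !big_ord_recr big_ord0 /= size_seps2 seps1.
have s4 : size (seps 4) = 22%N.
  by rewrite (seps_conv 3) !big_ord_recr big_ord0 /= s3 size_seps2 seps1.
split=> //; split=> k hk.
  by have := main 3%N k isT hk; rewrite card_Ssep_size // s3 mulrC.
by have := main 4%N k isT hk; rewrite card_Ssep_size // s4 mulrC.
Qed.
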